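(* Let $k\ge 1$ and let $f(x) = x^k + c_1 x^{k-1} + \cdots + c_k$ be a polynomial with real coefficients such that $f(x) > 0$ for all real $x \geq 0$. Then there exist polynomials $f_1(x)$ and $f_2(x)$ with positive coefficients such that $$f(x) = \dfrac{f_2(x)}{f_1(x)}.$$
   Context: A univariate real polynomial $g(x)=g_0+g_1x+\cdots+g_dx^d$ of degree $d$ is said to have positive coefficients if $g_i>0$ for every $i=0,1,\ldots,d$. *)

(* Defs.v *)
From HB Require Import structures.
From mathcomp Require Import all_boot all_order all_algebra.
From mathcomp Require Import reals.

Set Implicit Arguments.
Unset Strict Implicit.
Unset Printing Implicit Defensive.

Import Order.TTheory GRing.Theory Num.Theory.
Local Open Scope ring_scope.

(* The condition g != 0 gives g a degree d, so that size g = d + 1; without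
   it, the zero polynomial (of size 0) would satisfy the condition vacuously. *)
Definition positive_coefficients (R : realType) (g : {poly R}) : Prop :=
  g != 0 /\ forall i : nat, (i < size g)%N -> 0 < g`_i.

(* Main.v *)
Require Import Defs.
From HB Require Import structures.
From mathcomp Require Import all_boot all_order all_algebra.
From mathcomp Require Import reals.
From mathcomp Require Import complex.
From mathcomp Require Import zify ring lra.

Import Order.TTheory GRing.Theory Num.Theory.
Local Open Scope ring_scope.

(** Call a polynomial tame if its coefficients are nonnegative and its constant
    term is positive, and call [p] positivizable if [g * p] is tame for some
    tame [g].  Positivizable polynomials are closed under products, so after
    factoring [f] over the reals only the quadratics [x^2 - 2 b x + c] with
    [b^2 < c] matter.  If [b <= 0] such a quadratic is tame.  Otherwise its
    product with [x^2 + 2 b x + c] is [q(x^2)], where [q] is the quadratic with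
    parameters [2 b^2 - c] and [c^2]: if the roots have argument [t], those of
    [q] have argument [2 t], so finitely many doublings lead to the first case.
    Finally, multiplying a tame polynomial by a long enough [1 + x + ... + x^n]
    makes all its coefficients positive. *)

Definition tame {R : numDomainType} (p : {poly R}) : bool :=
  (p \is a polyOver (@Num.Def.nneg_num_pred R)) && (0 < p.[0]).

Definition positivizable {R : numDomainType} (p : {poly R}) : Prop :=
  exists2 g : {poly R}, tame g & tame (g * p).

Lemma tameM {R : numDomainType} (p q : {poly R}) :
  tame p -> tame q -> tame (p * q).
Proof.
move=> /andP[pN p0] /andP[qN q0]; rewrite /tame rpredM //=.
by rewrite hornerM mulr_gt0.
Qed.

(** Used to turn a multiplier for a quadratic [q] into one for [q(x^2)]. *)
Lemma tame_comp_Xsqr {R : numDomainType} (p : {poly R}) :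
  tame p -> tame (p \Po 'X^2).
Proof.
move=> /andP[pN p0]; rewrite /tame polyOver_comp ?rpredX ?polyOverX //=.
by rewrite horner_comp hornerXn expr0n.
Qed.

Lemma tame_positivizable {R : numDomainType} (p : {poly R}) :
  tame p -> positivizable p.
Proof.
move=> tp; exists 1; last by rewrite mul1r.
by rewrite /tame rpred1 hornerC ltr01.
Qed.

Lemma positivizableM {R : numDomainType} (p q : {poly R}) :
  positivizable p -> positivizable q -> positivizable (p * q).
Proof.
move=> [g tg tgp] [h th thq]; exists (g * h); first exact: tameM.
by rewrite mulrACA; apply: tameM.
Qed.

Lemma tame_quadratic {R : numDomainType} (b c : R) :
  b <= 0 -> 0 < c -> tame ('X^2 - (2 * b) *: 'X + c%:P).
Proof.
move=> b0 c0; apply/andP; split; last first.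
  by rewrite !hornerE /= ?(expr0n, mulr0, subr0, add0r).
rewrite -scaleNr; apply: rpredD; last by rewrite polyOverC unfold_in /= ltW.
apply: rpredD; first by rewrite rpredX ?polyOverX.
apply: polyOverZ; last exact: polyOverX.
by rewrite unfold_in /= -mulrN mulr_ge0 ?oppr_ge0.
Qed.

Lemma positivizable_quadratic {R : archiRealFieldType} (b c : R) :
  b ^+ 2 < c -> positivizable ('X^2 - (2 * b) *: 'X + c%:P).
Proof.
move=> bc; have c0 : 0 < c by apply: le_lt_trans bc; apply: sqr_ge0.
(* The ratio (c - b^2) / c is the squared sine of the argument of the roots;
   it at least doubles as long as the doubled argument is acute. *)
have [n cn] : exists n, c <= (c - b ^+ 2) * 2 ^+ n.
  exists (Num.bound (c / (c - b ^+ 2))).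
  rewrite mulrC -ler_pdivrMr ?subr_gt0 //.
  by apply/ltW; apply: upper_nthrootP.
elim: n b c bc c0 cn => [|n IHn] b c bc c0 cn.
  (* For [n = 0] the bound reads [c <= c - b^2], which forces [b = 0]. *)
  apply: tame_positivizable; apply: tame_quadratic => //.
  have := sqr_ge0 b; rewrite expr0 mulr1 in cn; nra.
have [b0|b0] := lerP b 0.
  by apply: tame_positivizable; apply: tame_quadratic.
have tq' : tame ('X^2 - (2 * - b) *: 'X + c%:P).
  by apply: tame_quadratic; rewrite // oppr_le0 ltW.
suff [g tg tgq] : positivizable ('X^2 - (2 * (2 * b ^+ 2 - c)) *: 'X + (c ^+ 2)%:P).
  exists ((g \Po 'X^2) * ('X^2 - (2 * - b) *: 'X + c%:P)).
    by apply: tameM => //; apply: tame_comp_Xsqr.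
  have := tame_comp_Xsqr _ tgq; congr (is_true (tame _)).
  rewrite comp_polyM -mulrA; congr (_ * _).
  rewrite comp_polyD comp_polyB comp_polyZ comp_polyX comp_polyC comp_Xn_poly.
  rewrite -!mul_polyC !(polyCM, polyCN, polyCB, polyC_exp).
  by rewrite (_ : 2%:P = 2 :> {poly R}) ?polyCMn //; ring.
have c20 : 0 < c ^+ 2 by rewrite exprn_gt0.
have [b'0|b'0] := lerP (2 * b ^+ 2 - c) 0.
  by apply: tame_positivizable; apply: tame_quadratic.
(* The new ratio is the old one times [4 b^2 / c], a factor above 2 because [2 b^2 > c] here; so the
   exponent drops from [n.+1] to [n]. *)
have E : c ^+ 2 - (2 * b ^+ 2 - c) ^+ 2 = (4 * b ^+ 2) * (c - b ^+ 2) by ring.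
have P : 0 < 4 * b ^+ 2 by rewrite mulr_gt0 ?exprn_gt0.
apply: IHn => //; first by rewrite -subr_gt0 E mulr_gt0 ?subr_gt0.
rewrite E -mulrA.
have H : c <= 2 * ((c - b ^+ 2) * 2 ^+ n) by rewrite mulrCA -exprS.
set u := _ * 2 ^+ n in H *.
have H2 : (2 * b ^+ 2) * c <= (2 * b ^+ 2) * (2 * u).
  by apply: ler_wpM2l => //; rewrite mulr_ge0 ?sqr_ge0.
have H3 : c * c <= (2 * b ^+ 2) * c by apply: ler_wpM2r; lra.
lra.
Qed.

(** Induction on the size: a complex root [a + ib] of a nonconstant [p] yields a real factor,
    [x - a] if [b = 0] and [(x - a)^2 + b^2] otherwise. That factor is positive on [x >= 0], hence
    so is the cofactor, to which induction applies. *)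
Lemma positivizable_of_pos {R : realType} (p : {poly R}) :
  (forall x : R, 0 <= x -> 0 < p.[x]) -> positivizable p.
Proof.
have [n] := ubnP (size p); elim: n p => // n IHn p szp ppos.
have [sz1|sz1] := eqVneq (size p) 1%N.
  have /size_poly1P[a a0 pE] : size p == 1%N by apply/eqP.
  apply: tame_positivizable; rewrite /tame ppos // andbT pE polyOverC unfold_in /=.
  by have := ppos 0 (lexx _); rewrite pE hornerC => /ltW.
have descent q : q %| p -> (1 < size q)%N -> positivizable q ->
    (forall x : R, 0 <= x -> 0 < q.[x]) -> positivizable p.
  move=> /divpK/esym; move: (p %/ q) => h pE szq posq qpos; rewrite pE; apply: positivizableM => //.
  have p0 : p != 0.
    by apply/eqP => p0; have := ppos 0 (lexx _); rewrite p0 horner0 ltxx.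
  have h0 : h != 0 by apply: contraNneq p0; rewrite pE => ->; rewrite mul0r.
  have q0 : q != 0 by apply: contraNneq p0; rewrite pE => ->; rewrite mulr0.
  apply: IHn => [|x x0].
    have ltn_deg a b : (1 < b)%N -> ((a + b).-1 < n.+1)%N -> (a < n)%N by lia.
    by apply: ltn_deg szq _; rewrite -size_mul // -pE.
  by have := ppos x x0; rewrite pE hornerM pmulr_lgt0 // qpos.
have /(@closed_rootP (complex.complex R))[[a b]] :
  size (map_poly (complex.real_complex R) p) != 1%N by rewrite size_map_poly.
move=> pz.
have [b0|b0] := eqVneq b 0.
  have pa : root p a.
    by move: pz; rewrite b0 -[complex.Complex a 0]/(complex.real_complex R a) fmorph_root.
  have a0 : a < 0.
    by rewrite ltNge; apply/negP => /ppos; rewrite (rootP pa) ltxx.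
  have xpos (x : R) : 0 <= x -> 0 < ('X - a%:P).[x].
    by move=> x0; rewrite hornerXsubC subr_gt0 (lt_le_trans a0).
  apply: (descent ('X - a%:P)) => //; first by rewrite dvdp_XsubCl.
    by rewrite size_XsubC.
  apply: tame_positivizable; rewrite /tame xpos // andbT.
  by rewrite -polyCN rpredD ?polyOverX // polyOverC unfold_in /= oppr_ge0 ltW.
have b2 : 0 < b ^+ 2 by rewrite exprn_even_gt0.
pose q := 'X^2 - (2 * a) *: 'X + (a ^+ 2 + b ^+ 2)%:P : {poly R}.
have szq : size q = 3%N.
  rewrite /q -addrA size_polyDl size_polyXn // -scaleNr.
  apply: leq_ltn_trans (size_polyD _ _) _; rewrite gtn_max; apply/andP; split.
    by apply: leq_ltn_trans (size_scale_leq _ _) _; rewrite size_polyX.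
  by apply: leq_ltn_trans (size_polyC_leq1 _) _.
apply: (descent q).
(* The remainder [r0 + r1 x] vanishes at [a + ib]. Its imaginary part there is [r1 b] with [b != 0],
   so [r1 = 0], and then [r0 = 0]. *)
- have rs : (size (p %% q)%R <= 2)%N.
    by have := ltn_modp p q; rewrite szq -size_poly_gt0 szq.
  apply/modp_eq0P.
  have : (map_poly (complex.real_complex R) (p %% q)).[complex.Complex a b] = 0.
    have qz : (map_poly (complex.real_complex R) q).[complex.Complex a b] = 0.
      rewrite (@horner_coef_wide _ 3) ?size_map_poly ?szq // !big_ord_recl big_ord0.
      rewrite !coef_map /q !coefE /=; apply/eqP; rewrite complex.eq_complex /=.
      by apply/andP; split; apply/eqP; ring.
    move: (rootP pz); rewrite {1}(divp_eq p q) rmorphD rmorphM hornerD hornerM qz.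
    by rewrite mulr0 add0r.
  rewrite (@horner_coef_wide _ 2) ?size_map_poly // big_ord_recl big_ord1 !coef_map.
  rewrite expr0 mulr1 expr1 => /eqP; rewrite complex.eq_complex /=.
  rewrite !mul0r add0r addr0 subr0 => /andP[/eqP r0 r1].
  have {}r1 : (p %% q)`_1 = 0 by apply/eqP; move: r1; rewrite mulf_eq0 (negPf b0) orbF.
  rewrite r1 mul0r addr0 in r0.
  apply/polyP => -[|[|i]]; rewrite coef0 //.
  by rewrite nth_default // (leq_trans rs).
- by rewrite szq.
- by apply: positivizable_quadratic; lra.
- move=> x _; rewrite /q !hornerE /=.
  by have := sqr_ge0 (x - a); nra.
Qed.

Lemma positive_coefficients_geometric (R : realType) (n : nat) :
  positive_coefficients (\poly_(i < n.+1) 1 : {poly R}).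
Proof.
have sz : size (\poly_(i < n.+1) (1 : R)) = n.+1 by rewrite size_poly_eq ?oner_eq0.
split; first by rewrite -size_poly_gt0 sz.
by move=> i; rewrite sz coef_poly => ->.
Qed.

(** Coefficient [i] of the product is a sum of nonnegative coefficients of [p] over the window
    [i - n <= j <= i], so one positive term suffices. The window contains the constant term if
    [i <= n], and otherwise the leading one, since [deg p <= n]. *)
Lemma tame_mul_geometric {R : realType} (p : {poly R}) (n : nat) :
  tame p -> (size p <= n.+1)%N ->
  positive_coefficients (\poly_(i < n.+1) 1 * p).
Proof.
move=> /andP[/polyOverP pN p0] szp.
have [S0 _] := positive_coefficients_geometric R n.
have p_neq0 : p != 0 by apply: contraTneq p0 => ->; rewrite horner0 ltxx.
have sz_gt0 : (0 < size p)%N by rewrite size_poly_gt0.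
split; first by rewrite mulf_neq0.
move=> i; rewrite size_mul // size_poly_eq ?oner_eq0 // => ilt.
rewrite mulrC coefM.
have key (j : 'I_i.+1) : 0 < p`_j -> (i - j < n.+1)%N ->
    0 < \sum_(j < i.+1) p`_j * (\poly_(i < n.+1) 1)`_(i - j).
  move=> pj jn; rewrite (bigD1 j) //= ltr_wpDr //; last first.
    by rewrite coef_poly jn mulr1.
  apply: sumr_ge0 => l _; rewrite coef_poly mulr_ge0 //; first by have := pN l.
  by case: ifP.
have [iln|nli] := ltnP i n.+1.
  by apply: (key ord0); rewrite ?subn0 // -horner_coef0.
have jlt : ((size p).-1 < i.+1)%N by lia.
have ltn_subpred s : (0 < s -> i < (n.+1 + s).-1 -> i - s.-1 < n.+1)%N by lia.
apply: (key (Ordinal jlt)) => /=; last exact: ltn_subpred.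
have := pN (size p).-1; rewrite unfold_in /= le_eqVlt => /predU1P[pj|//].
by move: p_neq0; rewrite -lead_coef_eq0 lead_coefE -pj eqxx.
Qed.

Theorem mainTheorem1 (R : realType) (k : nat) (hk : (1 <= k)%N)
    (c : nat -> R) (f : {poly R})
    (hf : f = 'X^k + \sum_(1 <= i < k.+1) c i *: 'X^(k - i))
    (hpos : forall x : R, 0 <= x -> 0 < f.[x]) :
  exists f1 f2 : {poly R},
    [/\ positive_coefficients f1,
        positive_coefficients f2 &
        tofrac f = tofrac f2 / tofrac f1].
Proof.
have [g tg tgf] := positivizable_of_pos f hpos.
(* A single geometric factor long enough for both [g] and [g * f] cancels in the quotient. *)
pose n := maxn (size g) (size (g * f)).
exists (\poly_(i < n.+1) 1 * g), (\poly_(i < n.+1) 1 * (g * f)).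
have P1 : positive_coefficients (\poly_(i < n.+1) 1 * g).
  by apply: tame_mul_geometric => //; rewrite leqW // leq_maxl.
split=> //; first by apply: tame_mul_geometric => //; rewrite leqW // leq_maxr.
case: P1 => g_neq0 _.
by rewrite mulrA tofracM mulrAC divff ?mul1r // tofrac_eq0.
Qed.
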